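(* Let $\mathbf{c}_0$ be a binary initial configuration on the directed path $P_n$. If the last $\lfloor\frac{n+1}{2}\rfloor$ positions of $\mathbf{c}_0$ are all non-zero, then $\mathcal{A}(P_n,\mathbf{c}_0)$ is contractible.
   Context: $P_n$ is the directed path with vertices $v_1,\dots,v_{n+1}$ and edges $(v_i,v_{i+1})$ for $i=1,\dots,n$. The vertex $v_{n+1}$ is a sink: it never fires, absorbs grains, and is not included in configurations or in the avalanche complex. A configuration is a vector $\mathbf{c}\in\mathbb{N}^n$ ($0\in\mathbb{N}$), where $\mathbf{c}(v_i)$ is the number of grains on $v_i$, $1\le i\le n$; it is binary if every entry is $0$ or $1$. Parallel-firing sandpile dynamics started from $\mathbf{c}_0$: at each time $t=0,1,2,\dots$ the firing set $\sigma_t$ is the set of $v_i$, $1\le i\le n$, with $\mathbf{c}_t(v_i)\ge 1$; all of these fire simultaneously, each sending one grain to $v_{i+1}$, so that $\mathbf{c}_{t+1}(v_i)=\mathbf{c}_t(v_i)-[v_i\in\sigma_t]+[v_{i-1}\in\sigma_t]$ for $1\le i\le n$ (where $[\cdot]$ is $1$ if the condition holds and $0$ otherwise, and the last term is $0$ for $i=1$). The avalanche complex $\mathcal{A}(P_n,\mathbf{c}_0)$ is the simplicial complex generated by the firing sets, i.e. the simplices are all nonempty subsets of the sets $\sigma_t$, $t\ge 0$ (vertices that never fire are not vertices of the complex). *)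

(* Defs.v *)
From HB Require Import structures.
From mathcomp Require Import all_boot all_order all_algebra.
From mathcomp Require Import all_classical all_reals all_analysis.

Set Implicit Arguments.
Unset Strict Implicit.
Unset Printing Implicit Defensive.

Import Order.TTheory GRing.Theory Num.Theory.
Import numFieldNormedType.Exports.

Local Open Scope classical_set_scope.
Local Open Scope ring_scope.

Record simplicial_complex (V : finType) := SimplicialComplex {
  simplices : set {set V};
  simplex_neq0 : forall s, simplices s -> s != finset.set0;
  simplex_down : forall s s' : {set V},
    simplices s -> s' \subset s -> s' != finset.set0 -> simplices s' }.

Section GeneratedComplex.
Variables (V : finType) (F : set {set V}).

Definition generated_simplices : set {set V} :=
  [set s | s != finset.set0 /\ exists2 f, F f & s \subset f].

Lemma generated_neq0 s : generated_simplices s -> s != finset.set0.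
Proof. by case. Qed.

Lemma generated_down (s s' : {set V}) :
  generated_simplices s -> s' \subset s -> s' != finset.set0 ->
  generated_simplices s'.
Proof.
move=> [_ [f Ff sf]] s's s'0; split=> //; exists f => //.
exact: fintype.subset_trans sf.
Qed.

Definition generated_complex : simplicial_complex V :=
  SimplicialComplex generated_neq0 generated_down.

End GeneratedComplex.

(* Barycentric coordinates: the i-th coordinate is the weight of the vertex i.
   An element of 'I_n that is not a vertex of K always has weight 0. *)
Definition realization (R : realType) (n : nat) (K : simplicial_complex 'I_n) :
    set 'rV[R]_n :=
  [set x : 'rV[R]_n | [/\ forall i, 0 <= x ord0 i, \sum_i x ord0 i = 1
             & simplices K [set i | x ord0 i != 0]%SET]].

(* The identity of X is homotopic to a constant map; in particular X is
   nonempty. The values of H at times outside [0, 1] are irrelevant. *)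
Definition contractible_space (R : realType) (X : topologicalType) : Prop :=
  exists (x0 : X) (H : R * X -> X),
    [/\ {within `[0, 1]%classic `*` [set: X], continuous H},
        forall x, H (0, x) = x
      & forall x, H (1, x) = x0].

(* The realization carries the subspace topology inherited from R^n. *)
Definition contractible (R : realType) (n : nat) (K : simplicial_complex 'I_n) :
    Prop :=
  contractible_space R (set_type (@realization R n K)).

(* The vertex v_(i+1) of P_n is represented by i : 'I_n; the sink is omitted. *)
Definition configuration (n : nat) := {ffun 'I_n -> nat}.

Definition binary (n : nat) (c : configuration n) : Prop :=
  forall i, c i = 0%N \/ c i = 1%N.

Definition firing_set (n : nat) (c : configuration n) : {set 'I_n} :=
  [set i | (1 <= c i)%N]%SET.

(* The truncated subtraction is exact, since a firing vertex has a grain. *)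
Definition fire (n : nat) (c : configuration n) : configuration n :=
  [ffun i : 'I_n =>
     (c i - (i \in firing_set c)
      + [exists j : 'I_n, (j.+1 == i :> nat) && (j \in firing_set c)])%N].

Definition config_at (n : nat) (c0 : configuration n) (t : nat) :
    configuration n :=
  iter t (@fire n) c0.

Definition avalanche_complex (n : nat) (c0 : configuration n) :
    simplicial_complex 'I_n :=
  generated_complex (range (fun t => firing_set (config_at c0 t))).

(* Main.v *)
Require Import Defs.
From mathcomp Require Import all_boot all_order all_algebra.
From mathcomp Require Import all_classical all_reals all_analysis.
From mathcomp Require Import zify.

(** The complex is a cone whose apex is the vertex [a] just before the sink; a
    cone is contracted by sliding every point along a segment to the apex
    ([contractible_cone]).

    On a binary configuration every grain moves one step to the right at each
    time, so the firing set at time [t] is the initial one translated by [t]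
    and truncated to the path ([in_firing_set_config_at]).  Let [m] be half the
    number of vertices, rounded up; the last [m] vertices carry a grain
    initially.  For [t < m] the grain starting [t] steps before [a] reaches
    [a] at time [t], so the firing set contains [a].  For [t >= m] only
    vertices at distance at least [m] from the left end can fire; those are
    among the last [m] vertices, so the firing set lies inside the initial one,
    which contains [a].  Hence every simplex lies in a firing set containing
    [a], that is, adding [a] to a simplex gives a simplex
    ([generated_complex_cone]). *)

Set Implicit Arguments.
Unset Strict Implicit.
Unset Printing Implicit Defensive.

Import Order.TTheory GRing.Theory Num.Theory.
Import numFieldNormedType.Exports.

Local Open Scope classical_set_scope.
Local Open Scope ring_scope.

(** A vertex with one grain always passes it on, so the grain found at [i] at
    time [t] can only be the one that started [t] steps before [i]. *)
Lemma binary_config_at n (c0 : configuration n) (t : nat) (i : 'I_n) :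
  binary c0 ->
  config_at c0 t i = [exists j : 'I_n, (j + t == i)%N && (0 < c0 j)%N] :> nat.
Proof.
move=> c0b; elim: t i => [|t IHt] i.
  have -> : [exists j : 'I_n, (j + 0 == i)%N && (0 < c0 j)%N] = (0 < c0 i)%N.
    apply/existsP/idP => [[j]|ci]; last by exists i; rewrite addn0 eqxx.
    by rewrite addn0 => /andP[/eqP/val_inj->].
  by case: (c0b i) => ci; rewrite /config_at /= ci.
(* By induction the vertex [i] has at most one grain, which it loses. *)
rewrite /config_at iterS -/(config_at c0 t) ffunE !inE IHt lt0b subnn add0n.
congr nat_of_bool; apply/existsP/existsP => [] [j /andP[/eqP ji]].
  rewrite inE IHt lt0b => /existsP[k /andP[/eqP kj ck]].
  by exists k; rewrite -ji -kj addnS eqxx.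
move=> cj; have jt : (j + t < n)%N by rewrite ltnW // -addnS ji.
exists (Ordinal jt); rewrite /= -addnS ji eqxx /= inE IHt lt0b.
by apply/existsP; exists j; rewrite eqxx.
Qed.

Lemma in_firing_set_config_at n (c0 : configuration n) (t : nat) (i : 'I_n) :
  binary c0 ->
  (i \in firing_set (config_at c0 t)) =
  [exists j : 'I_n, (j + t == i)%N && (j \in firing_set c0)].
Proof.
move=> c0b; rewrite inE binary_config_at // lt0b.
by apply: eq_existsb => j; rewrite inE.
Qed.

(** Enlarging a generator [f] to a generator [g] containing [a] leaves room for
    [a] in every face of [f]. *)
Lemma generated_complex_cone (V : finType) (F : set {set V}) (a : V) :
  (forall f, F f -> exists g, [/\ F g, a \in g & f \subset g]) ->
  forall s, simplices (generated_complex F) s ->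
            simplices (generated_complex F) (a |: s)%SET.
Proof.
move=> Fa s [s0 [f /Fa[g [Fg ag fg]] sf]]; split.
  by apply/set0Pn; exists a; rewrite setU11.
exists g => //.
by rewrite finset.subUset finset.sub1set ag (fintype.subset_trans sf).
Qed.

Lemma realization_vertex (R : realType) n (K : simplicial_complex 'I_n)
    (a : 'I_n) :
  simplices K [set a]%SET -> @realization R n K (delta_mx ord0 a).
Proof.
move=> Ka; split.
- by move=> i; rewrite mxE; case: (_ && _).
- rewrite (bigD1 a) //= big1 ?mxE ?eqxx ?addr0 // => i ia.
  by rewrite mxE (negbTE ia) andbF.
- congr (simplices K _): Ka; apply/finset.setP => i.
  by rewrite !inE mxE eqxx /=; case: eqP => _; rewrite ?oner_eq0 ?eqxx.
Qed.

(** A point between [x] and the vertex [a] is supported on the support of [x]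
    together with [a], so it stays in the realization of a cone with
    apex [a]. *)
Lemma realization_segment (R : realType) n (K : simplicial_complex 'I_n)
    (a : 'I_n) (r : R) (x : 'rV[R]_n) :
  (forall s, simplices K s -> simplices K (a |: s)%SET) ->
  0 <= r <= 1 -> realization K x ->
  realization K ((1 - r) *: x + r *: delta_mx ord0 a).
Proof.
move=> coneK /andP[r0 r1] [x0 xs xK].
set y := _ + _.
have yE i : y ord0 i = (1 - r) * x ord0 i + r * (i == a)%:R.
  by rewrite !mxE.
have y0 i : 0 <= y ord0 i.
  by rewrite yE addr_ge0 // mulr_ge0 // subr_ge0.
have ys : \sum_i y ord0 i = 1.
  under eq_bigr do rewrite yE.
  rewrite big_split -!mulr_sumr /= xs (bigD1 a) //= eqxx big1 => [|i /negbTE-> //].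
  by rewrite addr0 !mulr1 subrK.
split=> //; apply: simplex_down (coneK _ xK) _ _.
  apply/fintype.subsetP => i; rewrite !inE yE; apply: contraNT.
  rewrite negb_or negbK => /andP[/negbTE-> /eqP->].
  by rewrite !mulr0 addr0.
(* The coordinates of [y] sum to 1, so they do not all vanish. *)
apply/negP => /eqP e; move: ys; rewrite big1 => [/eqP|i _].
  by rewrite eq_sym oner_eq0.
by apply/eqP; move/finset.setP/(_ i): e; rewrite !inE => /negbFE.
Qed.

Lemma contractible_cone (R : realType) n (K : simplicial_complex 'I_n)
    (a : 'I_n) :
  simplices K [set a]%SET ->
  (forall s, simplices K s -> simplices K (a |: s)%SET) ->
  contractible R K.
Proof.
move=> Ka coneK; pose X := set_type (@realization R n K).
(* The homotopy must take values in the realization at all real times, hence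
   the projection of the time onto the unit interval. *)
pose clamp (r : R) : R := Num.max 0 (Num.min 1 r).
have clampP r : 0 <= clamp r <= 1.
  by rewrite /clamp le_max lexx /= ge_max ler01 ge_min lexx.
pose h (p : R * X) : 'rV[R]_n :=
  (1 - clamp p.1) *: set_val p.2 + clamp p.1 *: delta_mx ord0 a.
have hK p : realization K (h p).
  by apply: realization_segment => //; exact: set_valP.
have h0 (x : X) : h (0, x) = set_val x.
  by rewrite /h /clamp /= min_r ?ler01 // maxxx subr0 scale1r scale0r addr0.
have h1 (x : X) : h (1, x) = delta_mx ord0 a.
  by rewrite /h /clamp /= minxx max_r ?ler01 // subrr scale0r scale1r add0r.
pose inX y (Ky : realization K y) : X := SigSub (mem_set Ky).
exists (inX _ (realization_vertex R Ka)), (fun p => inX _ (hK p)).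
split=> [|x|x]; [|by apply: val_inj; rewrite /= h0|
                  by apply: val_inj; rewrite /= h1].
(* The realization has the initial topology of its inclusion in the space of
   row vectors, so continuity can be tested there. *)
apply: continuous_subspaceT; apply: continuous_comp_initial.
rewrite -[X in continuous X]/h.
have cclamp : continuous (fun p : R * X => clamp p.1).
  have cr : continuous clamp.
    move=> r; refine (@continuous_max R R (fun=> 0) (Num.min 1) r _ _).
      exact: cst_continuous.
    refine (@continuous_min R R (fun=> 1) id r _ _); last exact: cvg_id.
    exact: cst_continuous.
  by move=> p; apply: continuous_comp (cr _); exact: cvg_fst.
move=> p; apply: cvgD; last by apply: cvgZr_tmp; exact: cclamp.
apply: cvgZ; first by apply: cvgB; [exact: cvg_cst|exact: cclamp].
apply: (@continuous_comp _ _ _ snd set_val); first exact: cvg_snd.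
exact: initial_continuous.
Qed.

Theorem lemma3p6 (R : realType) (n : nat) (n_gt0 : (0 < n)%N)
    (c0 : configuration n) (c0_binary : binary c0)
    (c0_last : forall i : 'I_n, (n - (n.+1)./2 <= i)%N -> c0 i <> 0%N) :
  contractible R (avalanche_complex c0).
Proof.
have last_lt : (n.-1 < n)%N by rewrite prednK.
pose a : 'I_n := Ordinal last_lt.
have tail0 (i : 'I_n) : (n - n.+1./2 <= i)%N -> i \in firing_set c0.
  by move=> /c0_last /eqP; rewrite inE lt0n.
have a0 : a \in firing_set c0 by apply: tail0 => /=; lia.
apply: (@contractible_cone _ _ _ a).
  split; first by apply/set0Pn; exists a; rewrite inE.
  by exists (firing_set c0); [exists 0%N|rewrite finset.sub1set].
apply: generated_complex_cone => _ [t _ <-].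
have [tm|mt] := ltnP t (n.+1)./2.
  exists (firing_set (config_at c0 t)); split=> //.
  rewrite in_firing_set_config_at //; apply/existsP.
  have jn : (n.-1 - t < n)%N by lia.
  exists (Ordinal jn); apply/andP; split; first by apply/eqP => /=; lia.
  by apply: tail0 => /=; lia.
exists (firing_set c0); split=> //; first by exists 0%N.
(* A grain at [i] has travelled [t] steps, so [i] is at least [t], which is at
   least [n.+1./2] and hence at least [n - n.+1./2]. *)
apply/fintype.subsetP => i; rewrite in_firing_set_config_at // => /existsP[j].
by move=> /andP[/eqP ji _]; apply: tail0; lia.
Qed.
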